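(* Let $\mathbb{P}$, $\hat{\mathbb{P}}$ be partial fields, $\phi:\hat{\mathbb{P}}\to\mathbb{P}$ a homomorphism and ${}^\uparrow:\mathcal{F}(\mathbb{P})\to\hat{\mathbb{P}}$ a lifting function for $\phi$, such that: (1) if $1+1\doteq0$ in $\mathbb{P}$ then $1+1\doteq0$ in $\hat{\mathbb{P}}$; (2) if $1+1$ is defined and nonzero in $\mathbb{P}$ then $1+1$ is defined and nonzero in $\hat{\mathbb{P}}$; (3) $p^\uparrow q^\uparrow r^\uparrow=1$ for all $p,q,r\in\mathcal{F}(\mathbb{P})$ with $pqr=1$. Then there exists a nontrivial homomorphism $\psi:\mathbb{L}\mathbb{P}\to\hat{\mathbb{P}}$.
   Context: A partial field is a tuple $\mathbb{P}=(P,+,\cdot,0,1)$ with $\cdot$ a binary and $+$ a partial binary operation satisfying: (P1) $(P\setminus\{0\},\cdot,1)$ is an abelian group; (P2) $p+0=p$; (P3) unique additive inverses $-p$; (P4) commutativity of defined sums; (P5) $p(q+r)$ defined iff $pq+pr$ defined, then equal; (P6) the associative law for defined multi-term sums. $p+q\doteq r$ means $p+q$ is defined and equals $r$. A homomorphism $\phi$ satisfies $\phi(pq)=\phi(p)\phi(q)$ and $\phi(p)+\phi(q)\doteq\phi(p+q)$ whenever $p+q$ is defined; it is trivial if $\phi(1)=0$. $\mathcal{F}(\mathbb{P})=\{p:1-p\in\mathbb{P}\}$. A lifting function for $\phi:\hat{\mathbb{P}}\to\mathbb{P}$ is ${}^\uparrow:\mathcal{F}(\mathbb{P})\to\hat{\mathbb{P}}$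 with $\phi(p^\uparrow)=p$, $p^\uparrow+q^\uparrow\doteq1$ whenever $p+q\doteq1$, and $p^\uparrow q^\uparrow=1$ whenever $pq=1$. For a commutative ring $R$ and $S\subseteq R^*$, $\mathbb{P}(R,S)$ has underlying set $\langle S\cup\{-1\}\rangle\cup\{0\}$, multiplication of $R$, and $p+q$ defined iff the ring sum lies in this set. The lift of $\mathbb{P}$: with indeterminates $\tilde F_{\mathbb{P}}=\{\tilde p:p\in\mathcal{F}(\mathbb{P})\}$, $R_{\mathbb{P}}=\mathbb{Z}[\tilde F_{\mathbb{P}}]$, and $I_{\mathbb{P}}$ the ideal generated by $\tilde0$, $\tilde1-1$, $\widetilde{-1}+1$ (if $-1\in\mathcal{F}(\mathbb{P})$), $\tilde p+\tilde q-1$ ($p+q\doteq1$), $\tilde p\tilde q-1$ ($pq=1$), $\tilde p\tilde q\tilde r-1$ ($pqr=1$), all for fundamental $p,q,r$; $\mathbb{L}\mathbb{P}=\mathbb{P}(R_{\mathbb{P}}/I_{\mathbb{P}},\{\tilde p+I_{\mathbb{P}}:p\in\mathcal{F}(\mathbb{P})\setminus\{0\}\})$. *)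

(* Defs.v *)
From HB Require Import structures.
From mathcomp Require Import all_boot all_algebra.
From mathcomp Require Import boolp.
From mathcomp.multinomials Require Import monalg.

Set Implicit Arguments.
Unset Strict Implicit.
Unset Printing Implicit Defensive.

Import GRing.Theory.
Local Open Scope ring_scope.

(* The partial sum p + q is [Some r] when it is defined and equal to r, and   *)
(* [None] when it is undefined.                                               *)
Record pfStruct := PfStruct {
  pf_sort :> choiceType;
  pf_add : pf_sort -> pf_sort -> option pf_sort;
  pf_mul : pf_sort -> pf_sort -> pf_sort;
  pf_zero : pf_sort;
  pf_one : pf_sort
}.

Declare Scope pf_scope.
Delimit Scope pf_scope with PF.
Notation "0" := (pf_zero _) : pf_scope.
Notation "1" := (pf_one _) : pf_scope.
Notation "p * q" := (pf_mul p q) : pf_scope.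
Notation "p + q" := (pf_add p q) : pf_scope.

Section Associative.
Variable P : pfStruct.

(* A bracketing of a formal sum; the multiset of summands is its list of      *)
(* leaves up to permutation.                                                  *)
Inductive sumtree := Leaf of P | Node of sumtree & sumtree.

Fixpoint leaves (t : sumtree) : seq P :=
  match t with
  | Leaf p => [:: p]
  | Node l r => leaves l ++ leaves r
  end.

Fixpoint sumtree_val (t : sumtree) : option P :=
  match t with
  | Leaf p => Some p
  | Node l r =>
      if sumtree_val l is Some u then
        if sumtree_val r is Some w then pf_add u w else None
      else None
  end.

(* If some bracketing of a multiset of summands is defined, then any other    *)
(* bracketing in which all the sums except possibly the outermost one are     *)
(* defined is itself defined, with the same value.                            *)
Definition associative_law : Prop :=
  forall (t l r : sumtree) (v u w : P),
    perm_eq (leaves t) (leaves (Node l r)) ->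
    sumtree_val t = Some v ->
    sumtree_val l = Some u -> sumtree_val r = Some w ->
    (u + w = Some v)%PF.

End Associative.

Local Open Scope pf_scope.

(* The products 0 * p are not constrained by the group axioms, and are fixed  *)
(* to be 0.  Distributivity is restricted to p <> 0: for p = 0 the sum        *)
(* p * q + p * r = 0 + 0 is always defined, so that requiring it to be        *)
(* defined exactly when q + r is would force + to be total.                   *)
Record is_partial_field (P : pfStruct) : Prop := IsPartialField {
  pf_one_neq0 : (1 : P) <> 0;
  pf_mul_neq0 : forall p q : P, p <> 0 -> q <> 0 -> p * q <> 0;
  pf_mulA : forall p q r : P, p <> 0 -> q <> 0 -> r <> 0 ->
    p * (q * r) = p * q * r;
  pf_mulC : forall p q : P, p <> 0 -> q <> 0 -> p * q = q * p;
  pf_mul1 : forall p : P, p <> 0 -> 1 * p = p;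
  pf_mulV : forall p : P, p <> 0 -> exists q : P, q <> 0 /\ q * p = 1;
  pf_mul0 : forall p : P, 0 * p = 0;
  pf_add0 : forall p : P, p + 0 = Some p;
  pf_opp : forall p : P, exists! q : P, p + q = Some 0;
  pf_addC : forall p q r : P, p + q = Some r -> q + p = Some r;
  pf_mulD : forall p q r : P, p <> 0 ->
    p * q + p * r = omap (pf_mul p) (q + r);
  pf_addA : associative_law P
}.

Definition pf_hom (P Q : pfStruct) (phi : P -> Q) : Prop :=
  (forall p q : P, phi (p * q) = phi p * phi q) /\
  (forall p q r : P, p + q = Some r -> phi p + phi q = Some (phi r)).

Definition pf_trivial (P Q : pfStruct) (phi : P -> Q) : Prop := phi 1 = 0.

(* 1 - p is defined; here q is -p. *)
Definition fundamental (P : pfStruct) (p : P) : Prop :=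
  exists q r : P, p + q = Some 0 /\ 1 + q = Some r.

Definition fund (P : pfStruct) := {p : P | `[< fundamental p >]}.

Definition lifting_function (P Ph : pfStruct) (phi : Ph -> P)
    (up : fund P -> Ph) : Prop :=
  [/\ forall p : fund P, phi (up p) = val p,
      forall p q : fund P, val p + val q = Some 1 -> up p + up q = Some 1
    & forall p q : fund P, val p * val q = 1 -> up p * up q = 1].

Section PartialFieldTheory.
Variables (P : pfStruct) (hP : is_partial_field P).

Lemma pf_oppU (p q q' : P) : p + q = Some 0 -> p + q' = Some 0 -> q = q'.
Proof. by case: (pf_opp hP p) => m [_ mU] /mU <- /mU <-. Qed.

Lemma pf_mulp0 (p : P) : p * 0 = 0.
Proof.
have [->|/eqP p0] := eqVneq p 0; first exact: pf_mul0.
have xx : p * 0 + p * 0 = Some (p * 0) by rewrite pf_mulD // pf_add0.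
have [y [xy _]] := pf_opp hP (p * 0).
have := pf_addA hP (t := Node (Node (Leaf (p * 0)) (Leaf (p * 0))) (Leaf y))
  (l := Leaf (p * 0)) (r := Node (Leaf (p * 0)) (Leaf y)).
rewrite /= !xx !xy => /(_ _ _ _ (perm_refl _) erefl erefl erefl).
by rewrite pf_add0 // => -[].
Qed.

Lemma pf_mulN (p m q : P) : q <> 0 -> p + m = Some 0 -> q * p + q * m = Some 0.
Proof. by move=> q0 pm; rewrite pf_mulD // pm /= pf_mulp0. Qed.

Lemma fundamental_inv (p q : P) :
  p <> 0 -> q <> 0 -> q * p = 1 -> fundamental p -> fundamental q.
Proof.
move=> p0 q0 qp [m [r [pm mr]]].
have [n [n1 _]] := pf_opp hP 1.
have n0 : n <> 0.
  move=> nE; case: (pf_one_neq0 hP).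
  by move: n1; rewrite nE pf_add0 // => -[].
have nM (z : P) : z <> 0 -> z + n * z = Some 0.
  move=> z0; have := pf_mulN z0 n1.
  by rewrite (pf_mulC hP z0 n0) (pf_mulC hP z0 (pf_one_neq0 hP)) pf_mul1.
have nn : n * n = 1 by apply: pf_oppU (nM _ n0) (pf_addC hP n1).
have qm : q * m = n by apply: (pf_oppU _ n1); rewrite -qp; apply: pf_mulN.
exists (n * q), (n * (q * r)); split; first exact: nM.
apply: (pf_addC hP); rewrite -nn pf_mulD //.
have -> : q + n = Some (q * r) => //.
have := pf_mulD hP 1 m q0.
by rewrite mr qm (pf_mulC hP q0 (pf_one_neq0 hP)) pf_mul1.
Qed.

End PartialFieldTheory.

Local Close Scope pf_scope.

(* The subgroup of the unit group of R generated by S and -1, for a set S of  *)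
(* units of R; the last clause is closure under inverses.                     *)
Inductive gen_group (R : comPzRingType) (S : R -> Prop) : R -> Prop :=
| gen_group_base x : S x -> gen_group S x
| gen_groupN1 : gen_group S (-1)
| gen_group1 : gen_group S 1
| gen_groupM x y : gen_group S x -> gen_group S y -> gen_group S (x * y)
| gen_groupV x y : gen_group S x -> x * y = 1 -> gen_group S y.

Section RingPartialField.
Variables (R : comPzRingType) (S : R -> Prop).

Definition pf_of_ring_mem (x : R) : bool := `[< gen_group S x \/ x = 0 >].

Definition pf_of_ring_sort := {x : R | pf_of_ring_mem x}.

Lemma pf_of_ring_mem0 : pf_of_ring_mem 0.
Proof. by apply/asboolP; right. Qed.

Lemma pf_of_ring_mem1 : pf_of_ring_mem 1.
Proof. by apply/asboolP; left; apply: gen_group1. Qed.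

Lemma pf_of_ring_memM (x y : pf_of_ring_sort) :
  pf_of_ring_mem (val x * val y).
Proof.
case: x y => [x xP] [y yP] /=; apply/asboolP.
case/asboolP: xP => [xG|->]; last by right; rewrite mul0r.
case/asboolP: yP => [yG|->]; last by right; rewrite mulr0.
by left; apply: gen_groupM.
Qed.

(* [insub] makes x + y defined exactly when the sum in R lies in the carrier. *)
Definition pf_of_ring : pfStruct := {|
  pf_sort := pf_of_ring_sort : choiceType;
  pf_add := fun x y : pf_of_ring_sort => insub (val x + val y);
  pf_mul := fun x y : pf_of_ring_sort => Sub _ (pf_of_ring_memM x y);
  pf_zero := Sub _ pf_of_ring_mem0;
  pf_one := Sub _ pf_of_ring_mem1
|}.

Hypothesis R_nontrivial : (1 : R) <> 0.
Hypothesis S_unit : forall x, S x -> exists y, x * y = 1.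

Lemma gen_group_unit x : gen_group S x -> exists y, x * y = 1.
Proof.
elim=> [z /S_unit //||| y z _ [y' yE] _ [z' zE]|y z _ _ yz].
- by exists (-1); rewrite mulrNN mulr1.
- by exists 1; rewrite mulr1.
- by exists (y' * z'); rewrite mulrACA yE zE mulr1.
- by exists y; rewrite mulrC.
Qed.

Lemma pf_of_ring_unit (p : pf_of_ring) : p <> 0%PF ->
  gen_group S (val p) /\ exists y, val p * y = 1.
Proof.
move=> p0; suff pG : gen_group S (val p) by split; last exact: gen_group_unit.
by case: (asboolP _ (valP p)) => // pE; case: p0; apply: val_inj.
Qed.

Lemma pf_of_ring_addE (p q r : pf_of_ring) :
  pf_add p q = Some r <-> val p + val q = val r.
Proof.
rewrite /=; split=> [|->]; last by rewrite valK.
by case: insubP => // u _ <- [->].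
Qed.

Lemma pf_of_ring_sumE (t : sumtree pf_of_ring) v :
  sumtree_val t = Some v -> val v = \sum_(p <- leaves t) val p.
Proof.
elim: t v => [p v [<-]|l IHl r IHr v]; first by rewrite big_seq1.
move=> /=; case: (sumtree_val l) IHl => // u /(_ u erefl) uE.
case: (sumtree_val r) IHr => // w /(_ w erefl) wE /pf_of_ring_addE <-.
by rewrite big_cat uE wE.
Qed.

Lemma pf_of_ring_partial_field : is_partial_field pf_of_ring.
Proof.
split.
- by move/(congr1 val).
- move=> p q /pf_of_ring_unit[_ [p' pp']] /pf_of_ring_unit[_ [q' qq']].
  move=> /(congr1 val)/= pq0; apply: R_nontrivial.
  by rewrite -[1]mulr1 -{1}pp' -qq' mulrACA pq0 mul0r.
- by move=> p q r _ _ _; apply: val_inj; rewrite /= mulrA.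
- by move=> p q _ _; apply: val_inj; rewrite /= mulrC.
- by move=> p _; apply: val_inj; rewrite /= mul1r.
- move=> p /pf_of_ring_unit[pG [q pq]].
  have qG : pf_of_ring_mem q by apply/asboolP; left; apply: gen_groupV pq.
  exists (Sub q qG); split; last by apply: val_inj; rewrite /= mulrC.
  by move=> /(congr1 val)/= q0; apply: R_nontrivial; rewrite -pq q0 mulr0.
- by move=> p; apply: val_inj; rewrite /= mul0r.
- by move=> p; apply/pf_of_ring_addE; rewrite /= addr0.
- move=> p; have pN : pf_of_ring_mem (- val p).
    case/asboolP: (valP p) => [pG|->]; apply/asboolP; last by right; rewrite oppr0.
    by left; rewrite -mulN1r; apply: gen_groupM => //; apply: gen_groupN1.
  exists (Sub (- val p) pN); split; first by apply/pf_of_ring_addE; rewrite /= subrr.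
  move=> q /pf_of_ring_addE/= pq; apply: val_inj => /=.
  by rewrite -[val q](addKr (val p)) pq addr0.
- by move=> p q r /pf_of_ring_addE pq; apply/pf_of_ring_addE; rewrite addrC.
- move=> p q r /pf_of_ring_unit[pG [p' pp']]; rewrite /= -mulrDr.
  case: insubP => [u _ uE|].
    case: insubP => [w _ wE|/negP[]] /=.
      by congr Some; apply: val_inj; rewrite /= wE.
    apply/asboolP; have /asboolP[uG|u0] := valP u.
      left; rewrite -[_ + _]mul1r -pp' -mulrA mulrCA -uE; apply: gen_groupM => //.
      exact: gen_groupV pp'.
    by right; rewrite -[_ + _]mul1r -pp' -mulrA mulrCA -uE u0 mulr0.
  case: insubP => //= w _ wE /negP[]; apply/asboolP; rewrite -wE.
  have /asboolP[wG|->] := valP w; last by right; rewrite mulr0.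
  by left; apply: gen_groupM.
- move=> t l r v u w tlr /pf_of_ring_sumE vE /pf_of_ring_sumE uE /pf_of_ring_sumE wE.
  by apply/pf_of_ring_addE; rewrite vE uE wE (perm_big _ tlr) big_cat.
Qed.

End RingPartialField.

Definition is_ideal (R : comPzRingType) (J : R -> Prop) : Prop :=
  [/\ J 0, forall x y, J x -> J y -> J (x + y)
    & forall a x, J x -> J (a * x)].

(* The library quotient by an ideal asks for a proper ideal, which cannot be  *)
(* known in advance for an ideal given by generators; hence the possibly zero *)
(* quotient ring below.                                                       *)
Section IdealQuotient.
Variables (R : comPzRingType) (G : R -> Prop).

Definition ideal_gen : {pred R} := fun x =>
  `[< forall J : R -> Prop, is_ideal J -> (forall y, G y -> J y) -> J x >].

Lemma ideal_gen_zmod_closed : zmod_closed ideal_gen.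
Proof.
split=> [|x y /asboolP xI /asboolP yI]; apply/asboolP => J JI GJ.
  by case: JI.
case: (JI) => _ JD JM; apply: JD; first exact: xI.
by rewrite -mulN1r; apply: JM; apply: yI.
Qed.

HB.instance Definition _ :=
  GRing.isZmodClosed.Build R ideal_gen ideal_gen_zmod_closed.

Lemma ideal_genM a x : x \in ideal_gen -> a * x \in ideal_gen.
Proof.
move=> /asboolP xI; apply/asboolP => J JI GJ.
by case: (JI) => _ _; apply; apply: xI.
Qed.

Local Open Scope quotient_scope.

Definition ideal_quo := Quotient.quot ideal_gen.

HB.instance Definition _ := GRing.Zmodule.on ideal_quo.
HB.instance Definition _ := EqQuotient.on ideal_quo.

Definition ideal_quo_pi (x : R) : ideal_quo := \pi_ideal_quo x.

Lemma ideal_quo_piE x y : ideal_quo_pi x = ideal_quo_pi y <-> x - y \in ideal_gen.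
Proof. by rewrite Quotient.idealrBE; split=> /eqP. Qed.

Lemma ideal_quo_piD x y : ideal_quo_pi (x + y) = ideal_quo_pi x + ideal_quo_pi y.
Proof. by rewrite /ideal_quo_pi Quotient.pi_add. Qed.

Definition ideal_quo_one : ideal_quo := ideal_quo_pi 1.
Definition ideal_quo_mul (x y : ideal_quo) : ideal_quo :=
  ideal_quo_pi (repr x * repr y).

Lemma ideal_quo_piM x y :
  ideal_quo_pi (x * y) = ideal_quo_mul (ideal_quo_pi x) (ideal_quo_pi y).
Proof.
apply/ideal_quo_piE.
have reprE z : z - repr (ideal_quo_pi z) \in ideal_gen.
  by apply/ideal_quo_piE; rewrite {2}/ideal_quo_pi reprK.
rewrite -[x * y](addrNK (x * repr (ideal_quo_pi y))) -mulrBr -addrA -mulrBl.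
apply: rpredD; first exact/ideal_genM/reprE.
by rewrite mulrC; apply/ideal_genM/reprE.
Qed.

Lemma ideal_quo_ind (Q : ideal_quo -> Prop) :
  (forall x, Q (ideal_quo_pi x)) -> forall x, Q x.
Proof. by move=> Qpi x; rewrite -[x]reprK; apply: Qpi. Qed.

Lemma ideal_quo_mulA : associative ideal_quo_mul.
Proof.
elim/ideal_quo_ind=> x; elim/ideal_quo_ind=> y; elim/ideal_quo_ind=> z.
by rewrite -!ideal_quo_piM mulrA.
Qed.

Lemma ideal_quo_mulC : commutative ideal_quo_mul.
Proof. by move=> x y; rewrite /ideal_quo_mul mulrC. Qed.

Lemma ideal_quo_mul1 : left_id ideal_quo_one ideal_quo_mul.
Proof. by elim/ideal_quo_ind=> x; rewrite -ideal_quo_piM mul1r. Qed.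

Lemma ideal_quo_mulDl : left_distributive ideal_quo_mul +%R.
Proof.
elim/ideal_quo_ind=> x; elim/ideal_quo_ind=> y; elim/ideal_quo_ind=> z.
by rewrite -ideal_quo_piD -!ideal_quo_piM mulrDl ideal_quo_piD.
Qed.

HB.instance Definition _ := GRing.Zmodule_isComPzRing.Build ideal_quo
  ideal_quo_mulA ideal_quo_mulC ideal_quo_mul1 ideal_quo_mulDl.

End IdealQuotient.

Section Lift.
Variable P : pfStruct.

Definition lift_ring : comPzRingType := {malg int[{cmonom fund P}]}.

Definition lift_var (p : fund P) : lift_ring := << ucm p >>.

(* In [lift_gen_N1] the hypothesis says that p = -1. *)
Inductive lift_gen : lift_ring -> Prop :=
| lift_gen_0 (p : fund P) : val p = 0%PF -> lift_gen (lift_var p)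
| lift_gen_1 (p : fund P) : val p = 1%PF -> lift_gen (lift_var p - 1)
| lift_gen_N1 (p : fund P) : (1 + val p = Some 0)%PF -> lift_gen (lift_var p + 1)
| lift_gen_D (p q : fund P) : (val p + val q = Some 1)%PF ->
    lift_gen (lift_var p + lift_var q - 1)
| lift_gen_M2 (p q : fund P) : (val p * val q = 1)%PF ->
    lift_gen (lift_var p * lift_var q - 1)
| lift_gen_M3 (p q r : fund P) : (val p * val q * val r = 1)%PF ->
    lift_gen (lift_var p * lift_var q * lift_var r - 1).

Definition lift_quo : comPzRingType := ideal_quo lift_gen.

Definition lift_units (x : lift_quo) : Prop :=
  exists2 p : fund P, val p <> 0%PF & x = ideal_quo_pi lift_gen (lift_var p).

Lemma lift_units_unit (x : lift_quo) :
  is_partial_field P -> lift_units x -> exists y, x * y = 1.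
Proof.
move=> hP [p p0 ->]; have [q [q0 qp]] := pf_mulV hP p0.
have qF : `[< fundamental q >].
  by apply/asboolP/(fundamental_inv hP p0 q0 qp); exact/asboolP/(valP p).
exists (ideal_quo_pi lift_gen (lift_var (Sub q qF))).
rewrite -[LHS]ideal_quo_piM; apply/ideal_quo_piE/asboolP => J _; apply.
by apply: lift_gen_M2; rewrite /= pf_mulC.
Qed.

Definition pf_lift : pfStruct := pf_of_ring lift_units.

Lemma pf_lift_partial_field :
  is_partial_field P -> (1 : lift_quo) <> 0 -> is_partial_field pf_lift.
Proof.
move=> hP lift10; apply: pf_of_ring_partial_field => // x.
exact: lift_units_unit.
Qed.

End Lift.

(* Main.v *)
(* Call a formal sum of elements of a partial field null when, after adding   *)
(* cancelling pairs c, -c, some bracketing of it has value 0.  The            *)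
(* associative law makes null sums behave as in a ring: if p + q - r is null  *)
(* then p + q is defined and equal to r.  Evaluating monomials through the    *)
(* lifting function, the polynomials whose values form a null sum are an      *)
(* ideal of R_P that contains the generators of I_P.  Each element of the     *)
(* lift is 0 or the class of a signed monomial whose inverse is again one, so *)
(* the value of that monomial is well defined and respects sums and products. *)
Require Import Defs.
From HB Require Import structures.
From mathcomp Require Import all_boot all_order all_algebra finmap.
From mathcomp Require Import boolp ring.
From mathcomp.multinomials Require Import monalg.

Set Implicit Arguments.
Unset Strict Implicit.
Unset Printing Implicit Defensive.

(** If [Ph] were a ring, sending each variable to its lift would define a ring map on R_P killing
    I_P. As [Ph] has only partial sums, the ideal of null forms replaces the kernel of that map.
    [null_sumP] turns a formal relation back into a defined sum. [signed_sum_eq0] and [null_formP]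
    make nullity independent of how a polynomial is written, and [null_formM] makes null forms an
    ideal. By [lift_gen_null] it contains the generators: most of the relations are properties of
    [up], those for 1 and 0 follow from hypothesis (3), and [upN1], for -1, also uses hypothesis
    (1). Hence signed monomials that agree in the lift have equal values. By [gen_group_upval] every
    element of the lift has a value; 1 has the value 1, so the map is nontrivial. *)

Local Open Scope pf_scope.

(** * Negation and null sums in a partial field *)

Section NullSums.
Variables (P : pfStruct) (hP : is_partial_field P).
Implicit Types (p q r : P) (s c : seq P) (t : sumtree P).

Lemma pf_mul_com : commutative (@pf_mul P).
Proof.
move=> p q; have [->|/eqP p0] := eqVneq p 0; first by rewrite pf_mul0 ?pf_mulp0.
have [->|/eqP q0] := eqVneq q 0; first by rewrite pf_mul0 ?pf_mulp0.
exact: pf_mulC.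
Qed.

Lemma pf_mul_assoc : associative (@pf_mul P).
Proof.
move=> p q r; have [->|/eqP p0] := eqVneq p 0; first by rewrite !pf_mul0.
have [->|/eqP q0] := eqVneq q 0.
  by rewrite (pf_mulp0 hP) !(pf_mul0 hP) (pf_mulp0 hP).
have [->|/eqP r0] := eqVneq r 0; first by rewrite !(pf_mulp0 hP).
exact: pf_mulA.
Qed.

Lemma pf_mul1p : left_id 1 (@pf_mul P).
Proof.
move=> p; have [->|/eqP p0] := eqVneq p 0; first by rewrite pf_mulp0.
exact: pf_mul1.
Qed.

Lemma pf_mulpI p q r : r <> 0 -> p * r = q * r -> p = q.
Proof.
move=> r0 pq; have [i [_ ir]] := pf_mulV hP r0.
by rewrite -[p]pf_mul1p -[q]pf_mul1p -ir -!pf_mul_assoc ![r * _]pf_mul_com pq.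
Qed.

Lemma pf_oppM p q r : q + r = Some 0 -> p * q + p * r = Some 0.
Proof.
move=> qr; have [->|/eqP p0] := eqVneq p 0; last exact: pf_mulN.
by rewrite !pf_mul0 ?pf_add0.
Qed.

Lemma pf_oppr_exists : exists n : P, 1 + n = Some 0.
Proof. by case: (pf_opp hP 1) => n []; exists n. Qed.

Definition pf_N1 : P := projT1 (cid pf_oppr_exists).

(** Written as a product, so that the sign rules reduce to laws of multiplication and [null_sum_neg]
    is an instance of [null_sum_mul]. *)
Definition pf_neg p := pf_N1 * p.

Lemma pf_addpN p : p + pf_neg p = Some 0.
Proof.
rewrite /pf_neg -{1}[p]pf_mul1p ![_ * p]pf_mul_com; apply: pf_oppM.
by rewrite /pf_N1; case: cid.
Qed.

Lemma pf_addNp p : pf_neg p + p = Some 0.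
Proof. exact/(pf_addC hP)/pf_addpN. Qed.

Lemma pf_negE p q : p + q = Some 0 -> q = pf_neg p.
Proof. by move=> pq; apply: pf_oppU hP _ _ _ pq (pf_addpN p). Qed.

Lemma pf_negK : involutive pf_neg.
Proof. by move=> p; rewrite -(pf_negE (pf_addNp p)). Qed.

Lemma pf_mulpN p q : p * pf_neg q = pf_neg (p * q).
Proof. by rewrite /pf_neg !pf_mul_assoc (pf_mul_com p). Qed.

Lemma pf_mulNp p q : pf_neg p * q = pf_neg (p * q).
Proof. by rewrite /pf_neg !pf_mul_assoc. Qed.

(** The pairs from [c] give closure under cancellation ([null_sum_cons2]), even when no bracketing
    of the remaining summands is defined. *)
Definition null_sum s := exists t c,
  sumtree_val t = Some (0 : P) /\ perm_eq (leaves t) (s ++ c ++ map pf_neg c).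

Lemma null_sum_perm s s' : perm_eq s s' -> null_sum s -> null_sum s'.
Proof.
move=> ss' [t [c [t0 tc]]]; exists t, c; split=> //.
by rewrite (perm_trans tc) // perm_cat2r.
Qed.

Lemma null_sum_nil : null_sum [::].
Proof.
(* A tree has at least one leaf, so the empty sum needs a cancelling pair. *)
exists (Node (Leaf (1 : P)) (Leaf (pf_neg 1))), [:: 1] => /=.
by rewrite pf_addpN.
Qed.

Lemma null_sum_cat s s' : null_sum s -> null_sum s' -> null_sum (s ++ s').
Proof.
move=> [t [c [t0 tc]]] [t' [c' [t'0 t'c']]]; exists (Node t t'), (c ++ c').
split; first by rewrite /= t0 t'0 pf_add0.
apply/permP => a; rewrite /= map_cat !count_cat.
by move: tc t'c' => /permP -> /permP ->; rewrite !count_cat; ring.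
Qed.

Lemma null_sum_cons2 p s : null_sum (p :: pf_neg p :: s) -> null_sum s.
Proof.
move=> [t [c [t0 tc]]]; exists t, (p :: c); split=> //.
apply/permP => a; move/permP: tc => ->.
by rewrite /= !count_cat /= count_cat /=; ring.
Qed.

Lemma null_sum_pair p : null_sum [:: p; pf_neg p].
Proof.
exists (Node (Leaf p) (Leaf (pf_neg p))), [::] => /=.
by rewrite pf_addpN.
Qed.

Lemma null_sum_mul p s : null_sum s -> null_sum (map (pf_mul p) s).
Proof.
move=> [t [c [t0 tc]]].
pose fix mt t := match t with
  | Leaf q => Leaf (p * q) | Node l r => Node (mt l) (mt r) end.
have mt_leaves u : leaves (mt u) = map (pf_mul p) (leaves u).
  by elim: u => //= l -> r ->; rewrite map_cat.
have mt_val u v : sumtree_val u = Some v -> sumtree_val (mt u) = Some (p * v).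
  elim: u v => [q v [->] //|l IHl r IHr v] /=.
  case: (sumtree_val l) IHl => // a /(_ _ erefl) ->.
  case: (sumtree_val r) IHr => // b /(_ _ erefl) -> ab.
  (* Distributivity is only available for [p <> 0]; for [p = 0] the claim is 0 + 0 = 0. *)
  have [->|/eqP p0] := eqVneq p 0; first by rewrite !pf_mul0 ?pf_add0.
  by rewrite pf_mulD // ab.
exists (mt t), (map (pf_mul p) c); split; first by rewrite (mt_val _ _ t0) pf_mulp0.
rewrite mt_leaves -map_comp -(eq_map (fun q => pf_mulpN p q)).
by rewrite (map_comp (pf_mul p) pf_neg) -!map_cat perm_map.
Qed.

Lemma null_sum_neg s : null_sum s -> null_sum (map pf_neg s).
Proof. exact: null_sum_mul. Qed.

Lemma null_sum_add p q r : p + q = Some r -> null_sum [:: p; q; pf_neg r].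
Proof.
move=> pq; exists (Node (Node (Leaf p) (Leaf q)) (Leaf (pf_neg r))), [::].
by rewrite /= pq pf_addpN.
Qed.

(* Rebracket the tree r + t, of value r: its leaves are also p on one side    *)
(* and q with cancelling pairs on the other.                                  *)
Lemma null_sumP p q r : null_sum [:: p; q; pf_neg r] -> p + q = Some r.
Proof.
move=> [t [c [t0 tc]]].
(* Each pair is summed to 0 before being added to [q], so every partial sum is defined and equals
   [q]. *)
pose pairs := foldr (fun x u => Node u (Node (Leaf x) (Leaf (pf_neg x)))) (Leaf q).
have pairs_val c' : sumtree_val (pairs c') = Some q.
  by elim: c' => //= x c' ->; rewrite pf_addpN pf_add0.
have pairs_leaves c' : perm_eq (leaves (pairs c')) (q :: c' ++ map pf_neg c').
  apply/permP => a; elim: c' => //= x c' IH.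
  by rewrite count_cat IH /= !count_cat /=; ring.
apply: (pf_addA hP (t := Node (Leaf r) t) (l := Leaf p) (r := pairs (r :: c))).
- move: tc (pairs_leaves (r :: c)) => /permP tc /permP pl; apply/permP => a.
  by rewrite /= tc pl /= !count_cat /=; ring.
- by rewrite /= t0 pf_add0.
- by [].
- exact: pairs_val.
Qed.

Lemma null_sum_eq p q : null_sum [:: p; pf_neg q] -> p = q.
Proof.
move=> pq; suff: p + 0 = Some q by rewrite pf_add0 // => -[].
apply: null_sumP; apply: null_sum_perm (null_sum_cat pq (_ : null_sum [:: 0])).
  by apply/permP => a; rewrite /=; ring.
by exists (Leaf 0), [::].
Qed.

(** Subtracting the null sum p + q' - r from p + q - r leaves q - q'. *)
Lemma pf_addI p q q' r : p + q = Some r -> p + q' = Some r -> q = q'.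
Proof.
move=> /null_sum_add pq /null_sum_add /null_sum_neg pq'.
apply: null_sum_eq; apply: (null_sum_cons2 (p := p)).
apply: (null_sum_cons2 (p := pf_neg r)); apply: null_sum_perm (null_sum_cat pq pq').
by apply/permP => a /=; ring.
Qed.

Lemma pf_addK p q r : p + q = Some r -> r + pf_neg q = Some p.
Proof.
move=> /null_sum_add /null_sum_neg pq; apply: null_sumP.
by apply: null_sum_perm pq; apply/permP => a; rewrite /= pf_negK; ring.
Qed.

End NullSums.

(** * Integer combinations of symbols and their values *)

Section FormalSums.
Local Open Scope ring_scope.
Import Order.TTheory GRing.Theory Num.Theory.
Variables (P : pfStruct) (hP : is_partial_field P).
Variables (K : choiceType) (e : K -> P).
Implicit Types (f g : {malg int[K]}) (L : seq (bool * K)) (b : bool) (k : K).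

(* The boolean tells whether the sign is negative. *)
Definition signed_mon b k : {malg int[K]} := if b then - << k >> else << k >>.

Definition signed_val b k : P := if b then pf_neg hP (e k) else e k.

Definition signed_sum L : {malg int[K]} := \sum_(x <- L) signed_mon x.1 x.2.

Definition vals L : seq P := [seq signed_val x.1 x.2 | x <- L].

Definition oppL L : seq (bool * K) := [seq (~~ x.1, x.2) | x <- L].

Lemma signed_monN b k : signed_mon (~~ b) k = - signed_mon b k.
Proof. by case: b; rewrite /= ?opprK. Qed.

Lemma signed_valN b k : signed_val (~~ b) k = pf_neg hP (signed_val b k).
Proof. by case: b; rewrite /= ?pf_negK. Qed.

Lemma signed_sum_cat L L' : signed_sum (L ++ L') = signed_sum L + signed_sum L'.
Proof. exact: big_cat. Qed.

Lemma vals_cat L L' : vals (L ++ L') = vals L ++ vals L'.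
Proof. exact: map_cat. Qed.

Lemma signed_sum_opp L : signed_sum (oppL L) = - signed_sum L.
Proof.
by rewrite /signed_sum big_map -sumrN; apply: eq_bigr => x _; rewrite signed_monN.
Qed.

Lemma vals_opp L : vals (oppL L) = map (pf_neg hP) (vals L).
Proof. by rewrite /vals -!map_comp; apply: eq_map => x /=; rewrite signed_valN. Qed.

(* A vanishing formal sum cancels in pairs: the first term must meet its      *)
(* opposite, for otherwise its coefficient would not be zero.                 *)
Lemma signed_sum_eq0 L : signed_sum L = 0 -> null_sum hP (vals L).
Proof.
have [n] := ubnP (size L); elim: n L => // n IH [|[b k] L] /= ltLn L0.
  exact: null_sum_nil.
have [kL|kL] := boolP ((~~ b, k) \in L); last first.
  (* With this sign the head contributes 1 and, its opposite being absent, every other term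
     contributes at least 0. *)
  have : (-1) ^+ b * (signed_sum ((b, k) :: L))@_k = 0 by rewrite L0 mcoeff0 mulr0.
  rewrite /signed_sum big_cons mcoeffD raddf_sum /= mulrDr mulr_sumr => /eqP.
  rewrite gt_eqF // ltr_pwDl //.
    by case: (b); rewrite /= ?mcoeffN mcoeffUU.
  rewrite big_seq sumr_ge0 // => -[b' k'] /= kL'.
  case: (eqVneq k' k) kL' => [->|k'k]; last first.
    by case: b'; rewrite /= ?mcoeffN mcoeffU (negbTE k'k) ?oppr0 mulr0.
  case: (eqVneq b' b) => [-> _|b'b]; first by case: (b); rewrite /= ?mcoeffN mcoeffUU.
  have -> : b' = ~~ b by case: (b) (b') b'b => -[].
  by rewrite (negbTE kL).
have pL := perm_to_rem kL.
have pLv := perm_map (fun x => signed_val x.1 x.2)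
  (_ : perm_eq [:: (b, k), (~~ b, k) & rem (~~ b, k) L] ((b, k) :: L)).
apply: null_sum_perm (pLv _) _; first by rewrite perm_cons perm_sym.
rewrite /= signed_valN.
apply: (null_sum_cat (null_sum_pair hP (signed_val b k)))
  (_ : null_sum hP (vals (rem (~~ b, k) L))).
apply: IH; first by rewrite size_rem // (leq_ltn_trans (leq_pred _)).
move: L0; rewrite /signed_sum big_cons (perm_big _ pL) big_cons /=.
by rewrite signed_monN addrA subrr add0r.
Qed.

Definition null_form f := exists2 L, f = signed_sum L & null_sum hP (vals L).

(** Nullity passes between presentations: if [L'] is the null one, L - L' vanishes formally, so its
    values are null. Adding those of [L'] leaves the values of [L] and cancelling pairs. *)
Lemma null_formP L : null_form (signed_sum L) -> null_sum hP (vals L).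
Proof.
move=> [L' LL' L'0].
have LoL' : null_sum hP (vals (L ++ oppL L')).
  apply: signed_sum_eq0.
  by rewrite signed_sum_cat signed_sum_opp LL' subrr.
have LL'K : null_sum hP (vals L ++ flatten [seq [:: v; pf_neg hP v] | v <- vals L']).
  apply: null_sum_perm (null_sum_cat LoL' L'0).
  apply/permP => a; rewrite vals_cat vals_opp -catA !count_cat.
  congr addn.
  elim: (vals L') => //= v l IH.
  by rewrite -IH; ring.
elim: (vals L') LL'K => [|v l IH] /=; first by rewrite cats0.
move=> vl; apply: IH; apply: (null_sum_cons2 (p := v)); apply: null_sum_perm vl.
by rewrite (perm_catCA _ [:: v; pf_neg hP v]).
Qed.

Lemma null_form_eqP b k b' k' :
  null_form (signed_mon b k - signed_mon b' k') <-> signed_val b k = signed_val b' k'.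
Proof.
have <- : signed_sum [:: (b, k); (~~ b', k')] = signed_mon b k - signed_mon b' k'.
  by rewrite /signed_sum !big_cons big_nil addr0 signed_monN.
split=> [/null_formP|kk'].
  by rewrite /= signed_valN; apply: null_sum_eq.
exists [:: (b, k); (~~ b', k')] => //.
by rewrite /= signed_valN kk'; apply: null_sum_pair.
Qed.

Lemma null_form_addP b k b' k' b'' k'' :
  null_form (signed_mon b k + signed_mon b' k' - signed_mon b'' k'') <->
  (signed_val b k + signed_val b' k' = Some (signed_val b'' k''))%PF.
Proof.
have <- : signed_sum [:: (b, k); (b', k'); (~~ b'', k'')] =
    signed_mon b k + signed_mon b' k' - signed_mon b'' k''.
  by rewrite /signed_sum !big_cons big_nil addr0 signed_monN addrA.
split=> [/null_formP|kk'].
  by rewrite /= signed_valN; apply: null_sumP.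
exists [:: (b, k); (b', k'); (~~ b'', k'')] => //.
by rewrite /= signed_valN; apply: null_sum_add.
Qed.

Lemma null_form0 : null_form 0.
Proof. by exists [::]; rewrite /signed_sum ?big_nil //; apply: null_sum_nil. Qed.

Lemma null_formD f g : null_form f -> null_form g -> null_form (f + g).
Proof.
move=> [L -> L0] [L' -> L'0]; exists (L ++ L'); first by rewrite signed_sum_cat.
by rewrite vals_cat; apply: null_sum_cat.
Qed.

Lemma null_formN f : null_form f -> null_form (- f).
Proof.
move=> [L -> L0]; exists (oppL L); first by rewrite signed_sum_opp.
by rewrite vals_opp; apply: null_sum_neg.
Qed.

Lemma null_formMz f (n : int) : null_form f -> null_form (f *~ n).
Proof.
move=> f0; have fn m : null_form (f *+ m).
  elim: m => [|m IH]; first by rewrite mulr0n; apply: null_form0.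
  by rewrite mulrS; apply: null_formD.
by case: n => m; [apply: fn|apply/null_formN/fn].
Qed.

End FormalSums.

(** * Null forms as an ideal, for a multiplicative valuation *)

Section MonomialForms.
Local Open Scope ring_scope.
Import GRing.Theory.
Variables (P : pfStruct) (hP : is_partial_field P).
Variables (K : conomType) (e : K -> P).
Hypothesis eM : forall k k', e (mmul k k') = (e k * e k')%PF.

Lemma signed_monM b b' (k k' : K) :
  signed_mon b k * signed_mon b' k' = signed_mon (b (+) b') (mmul k k').
Proof.
have kk' : << k >> * << k' >> = << mmul k k' >> :> {malg int[K]}.
  by rewrite malgM_def fgmulUU mulr1.
by case: b b' => -[]; rewrite /= ?mulrNN ?mulrN ?mulNr kk'.
Qed.

Lemma signed_valM b b' (k k' : K) :
  (signed_val hP e b k * signed_val hP e b' k')%PF =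
  signed_val hP e (b (+) b') (mmul k k').
Proof. by case: b b' => -[] /=; rewrite ?pf_mulNp ?pf_mulpN ?pf_negK eM. Qed.

Lemma null_formM (f g : {malg int[K]}) : null_form hP e g -> null_form hP e (f * g).
Proof.
move=> g0; rewrite [f]monalgE mulr_suml.
(* By additivity [f] may be taken to be an integer multiple of one monomial [k], which scales all
   values by [e k]. *)
apply: big_ind => [||k _]; [exact: null_form0|exact: null_formD|].
rewrite -[f@_k]intz (raddfMz (mkmalgU k)) mulrzAl.
apply: null_formMz; case: g0 => L -> L0.
exists [seq (x.1, mmul k x.2) | x <- L].
  rewrite /signed_sum mulr_sumr big_map; apply: eq_bigr => x _.
  by rewrite (signed_monM false).
suff -> : vals hP e [seq (x.1, mmul k x.2) | x <- L] =
    map (pf_mul (e k)) (vals hP e L).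
  exact: null_sum_mul.
rewrite /vals -!map_comp; apply: eq_map => x /=.
by rewrite -(signed_valM false).
Qed.

End MonomialForms.

(** * Evaluation of monomials *)

Section MonomialValue.
Variables (P : pfStruct) (hP : is_partial_field P).
Variables (I : choiceType) (u : I -> P).

HB.instance Definition _ := Monoid.isComLaw.Build P 1 (@pf_mul P)
  (pf_mul_assoc hP) (pf_mul_com hP) (pf_mul1p hP).

Definition cmonom_val (m : {cmonom I}) : P :=
  \big[@pf_mul P/1]_(i <- finsupp m) iter (m i) (pf_mul (u i)) 1.

(** Exponent 0 contributes the factor 1; this lets two monomials be multiplied over the union of
    their supports. *)
Lemma cmonom_valEw (m : {cmonom I}) (d : {fset I}) : (finsupp m `<=` d)%fset ->
  cmonom_val m = \big[@pf_mul P/1]_(i <- d) iter (m i) (pf_mul (u i)) 1.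
Proof.
move=> md; rewrite /cmonom_val (big_fset_incl _ md) // => i _.
by rewrite -cmE_neq0 negbK => /eqP ->.
Qed.

Lemma cmonom_val1 : cmonom_val mone = 1.
Proof. by rewrite /cmonom_val mdom1 big_seq_fset0. Qed.

Lemma cmonom_valU i : cmonom_val (ucm i) = u i.
Proof.
by rewrite /cmonom_val mdomU big_seq_fset1 cmUU /= pf_mul_com // pf_mul1p.
Qed.

Lemma cmonom_valM m m' : cmonom_val (mmul m m') = cmonom_val m * cmonom_val m'.
Proof.
rewrite (cmonom_valEw (fsubsetUl (finsupp m) (finsupp m'))).
rewrite (cmonom_valEw (fsubsetUr (finsupp m) (finsupp m'))).
rewrite (cmonom_valEw (d := (finsupp m `|` finsupp m')%fset)) ?mdomD //.
rewrite -big_split /=; apply: eq_bigr => i _; rewrite cmM.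
elim: (m i) => [|n IH] /=; first by rewrite pf_mul1p.
by rewrite IH pf_mul_assoc.
Qed.

End MonomialValue.

(** * Zero and opposites in the quotient ring *)

Section IdealQuotientTheory.
Local Open Scope ring_scope.
Import GRing.Theory.
Variables (R : comPzRingType) (G : R -> Prop).

Lemma ideal_quo_pi0 : ideal_quo_pi G 0 = 0.
Proof. by apply: (addrI (ideal_quo_pi G 0)); rewrite -ideal_quo_piD !addr0. Qed.

Lemma ideal_quo_piN x : ideal_quo_pi G (- x) = - ideal_quo_pi G x.
Proof.
by apply: (addrI (ideal_quo_pi G x)); rewrite -ideal_quo_piD !subrr ideal_quo_pi0.
Qed.

End IdealQuotientTheory.

(** * Values in [Ph] of the elements of the lift *)

Section LiftedValues.
Local Open Scope ring_scope.
Import GRing.Theory.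
Variables (P Ph : pfStruct).
Hypotheses (hP : is_partial_field P) (hPh : is_partial_field Ph).
Variables (phi : Ph -> P) (up : fund P -> Ph).
Hypotheses (hphi : pf_hom phi) (hup : lifting_function phi up).
Hypothesis h1 : (1 + 1 = Some (0 : P))%PF -> (1 + 1 = Some (0 : Ph))%PF.
Hypothesis h3 : forall p q r : fund P,
  (val p * val q * val r = 1)%PF -> (up p * up q * up r = 1)%PF.

Local Notation upval := (cmonom_val up).
Local Notation upnull := (null_form hPh upval).

Lemma pf_hom0 : phi 0%PF = 0%PF.
Proof.
case: hphi => _ phiD; apply: (pf_addI hP (p := phi 0%PF) (r := phi 0%PF)).
  by apply: phiD; apply: pf_add0.
exact: pf_add0.
Qed.

Lemma up1 (p : fund P) : val p = 1%PF -> up p = 1%PF.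
Proof.
case: hup => _ _ upV p1; have := @h3 p p p; rewrite p1 !pf_mul1p // => /(_ erefl).
by rewrite upV ?p1 ?pf_mul1p.
Qed.

Lemma up0 (p : fund P) : val p = 0%PF -> up p = 0%PF.
Proof.
case: hup => _ upD _ p0.
have F1 : `[< fundamental (1 : P)%PF >].
  by apply/asboolP; exists (pf_neg hP 1%PF), 0%PF; rewrite pf_addpN.
have := upD (Sub 1%PF F1) p; rewrite p0 pf_add0 // up1 // => /(_ erefl) u1.
exact: (pf_addI hPh u1 (pf_add0 hPh 1%PF)).
Qed.

(* With a the lift of -1 and b = 1 - a the lift of 2, a * a = 1 gives         *)
(* a * b = a - 1 = - b, whence a = -1 when 2 <> 0.                            *)
Lemma upN1 (p : fund P) : (1 + val p = Some 0)%PF -> up p = pf_neg hPh 1%PF.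
Proof.
case: (hup) => phiK upD upV p1; have pE := pf_negE hP p1.
have [m [r []]] := asboolP _ (valP p).
move=> /(pf_oppU hP (pf_addC hP p1)) <- r2.
(* Here [r] is 1 + 1. If it is 0, then -1 = 1 in [P], and by [h1] also in [Ph]. *)
have [r0|/eqP r0] := eqVneq r 0%PF.
  rewrite r0 in r2; rewrite (up1 (pf_oppU hP p1 r2)).
  exact/pf_negE/h1.
have rp : (val p + r = Some 1)%PF.
  by apply: (pf_addC hP); rewrite pE; apply: pf_addK.
have Fr : `[< fundamental r >].
  by apply/asboolP; exists (pf_neg hP r), (val p); rewrite pf_addpN (pf_addK hP rp).
have ab := upD p (Sub r Fr) rp.
have aa : (up p * up p = 1)%PF.
  by apply: upV; rewrite pE pf_mulNp pf_mul1p // pf_negK.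
set a := up p in ab aa *; set b := up _ in ab.
have b0 : b <> 0%PF.
  by move=> b0; apply: r0; have <- : phi b = r := phiK _; rewrite b0 pf_hom0.
apply: (pf_mulpI hPh b0); rewrite pf_mulNp pf_mul1p //; apply: (null_sum_eq (hP := hPh)).
(* The null sums a + b - 1 and its multiple 1 + a b - a add up to a b + b after cancellation. *)
have ab0 := null_sum_add hPh ab; have := null_sum_mul a ab0.
rewrite /= aa pf_mulpN (pf_mul_com hPh a 1%PF) pf_mul1p // => aab0.
apply: (null_sum_cons2 (p := a)); apply: (null_sum_cons2 (p := 1%PF)).
apply: null_sum_perm (null_sum_cat ab0 aab0).
by apply/permP => c; rewrite /= pf_negK; ring.
Qed.

Lemma lift_gen_null (f : lift_ring P) : lift_gen f -> upnull f.
Proof.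
have [_ upD upV] := hup.
case=> [p p0|p p1|p p1|p q pq|p q pq|p q r pqr].
- exists [:: (false, ucm p)]; first by rewrite /signed_sum big_seq1.
  by rewrite /= cmonom_valU // up0 //; exists (Leaf 0%PF), [::].
- apply/(null_form_eqP _ _ false _ false mone).
  by rewrite /= cmonom_valU // cmonom_val1 // up1.
- rewrite -[X in _ + X]opprK; apply/(null_form_eqP _ _ false _ true mone).
  by rewrite /= cmonom_valU // cmonom_val1 // upN1.
- apply/(null_form_addP _ _ false _ false _ false mone).
  by rewrite /= !cmonom_valU // cmonom_val1 // upD.
- rewrite /lift_var; have := signed_monM false false (ucm p) (ucm q) => /= ->.
  apply/(null_form_eqP _ _ false _ false mone).
  by rewrite /= cmonom_valM // !cmonom_valU // cmonom_val1 // upV.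
- rewrite /lift_var; have := signed_monM false false (ucm p) (ucm q) => /= ->.
  have := signed_monM false false (mmul (ucm p) (ucm q)) (ucm r) => /= ->.
  apply/(null_form_eqP _ _ false _ false mone).
  by rewrite /= !cmonom_valM // !cmonom_valU // cmonom_val1 // h3.
Qed.

Lemma ideal_gen_null (f : lift_ring P) : f \in ideal_gen (@lift_gen P) -> upnull f.
Proof.
move/asboolP; apply; last exact: lift_gen_null.
split; [exact: null_form0|exact: null_formD|].
by move=> a x; apply: null_formM; exact: cmonom_valM.
Qed.

Local Notation lift_pi := (ideal_quo_pi (@lift_gen P)).
Local Notation upsval := (signed_val hPh upval).

(** A relation, since a class may contain several signed monomials and none is singled out. *)
Definition has_upval (x : lift_quo P) (v : Ph) :=
  exists b k, x = lift_pi (signed_mon b k) /\ v = upsval b k.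

Lemma has_upval_uniq x v v' : has_upval x v -> has_upval x v' -> v = v'.
Proof.
move=> [b [k [-> ->]]] [b' [k' [/ideal_quo_piE/ideal_gen_null kk' ->]]].
exact/null_form_eqP.
Qed.

Lemma has_upvalM x y u v : has_upval x u -> has_upval y v ->
  has_upval (x * y) (u * v)%PF.
Proof.
move=> [b [k [-> ->]]] [b' [k' [-> ->]]]; exists (b (+) b'), (mmul k k').
by rewrite -signed_monM signed_valM ?ideal_quo_piM //; apply: cmonom_valM.
Qed.

Lemma has_upvalD x y u v w : has_upval x u -> has_upval y v ->
  has_upval (x + y) w -> (u + v = Some w)%PF.
Proof.
move=> [b [k [-> ->]]] [b' [k' [-> ->]]] [b'' [k'' []]].
rewrite -ideal_quo_piD => /ideal_quo_piE/ideal_gen_null kk' ->.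
exact/null_form_addP.
Qed.

Lemma has_upval1 : has_upval 1 1%PF.
Proof. by exists false, mone; rewrite /= cmonom_val1. Qed.

Lemma has_upvalN1 : has_upval (-1) (pf_neg hPh 1%PF).
Proof. by exists true, mone; rewrite /= cmonom_val1 // ideal_quo_piN. Qed.

Lemma has_upval0 : has_upval 0 0%PF.
Proof.
have F0 : `[< fundamental (0 : P)%PF >].
  by apply/asboolP; exists 0%PF, 1%PF; rewrite !pf_add0.
exists false, (ucm (Sub 0%PF F0)); rewrite /= cmonom_valU // up0 //; split=> //.
rewrite -(ideal_quo_pi0 (@lift_gen P)).
apply/ideal_quo_piE/asboolP => J JI GJ; rewrite sub0r -mulN1r.
by case: JI => _ _; apply; apply: GJ; apply: lift_gen_0.
Qed.

(** The inverse and its value are carried through the induction because the group is closed under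
    inverses; for a variable the inverse is the variable of the inverse, again fundamental. *)
Lemma gen_group_upval x : gen_group (@lift_units P) x ->
  exists y, [/\ x * y = 1, exists v, has_upval x v & exists v, has_upval y v].
Proof.
elim=> {x} [x [p p0 ->]|||x y _ [x' [xx' [u ux] [u' ux']]] _ [y' [yy' [v vy] [v' vy']]]
  |x y _ [x' [xx' ex [u' ux']]] xy].
- have [q [q0 qp]] := pf_mulV hP p0.
  have qF : `[< fundamental q >].
    by apply/asboolP/(fundamental_inv hP p0 q0 qp); exact/asboolP/(valP p).
  exists (lift_pi (lift_var (Sub q qF))); split.
  + rewrite -[LHS]ideal_quo_piM; apply/ideal_quo_piE/asboolP => J _; apply.
    by apply: lift_gen_M2; rewrite /= pf_mul_com.
  + by exists (upsval false (ucm p)), false, (ucm p).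
  + by exists (upsval false (ucm (Sub q qF))), false, (ucm (Sub q qF)).
- by exists (-1); split; rewrite ?mulrNN ?mulr1 //; exists (pf_neg hPh 1%PF);
    apply: has_upvalN1.
- by exists 1; split; rewrite ?mulr1 //; exists 1%PF; apply: has_upval1.
- exists (x' * y'); split; first by rewrite mulrACA xx' yy' mulr1.
    by exists (u * v)%PF; apply: has_upvalM.
  by exists (u' * v')%PF; apply: has_upvalM.
- have -> : y = x' by rewrite -[x']mul1r -xy mulrAC xx' mul1r.
  exists x; split.
  + exact: (etrans (mulrC x' x) xx').
  + by exists u'.
  + exact: ex.
Qed.

Lemma pf_lift_upval (z : pf_lift P) : exists v, has_upval (val z) v.
Proof.
case/asboolP: (valP z) => [/gen_group_upval[_ []] //|->].
by exists 0%PF; apply: has_upval0.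
Qed.

End LiftedValues.

Theorem theorem5p9 (P Ph : pfStruct)
    (hP : is_partial_field P) (hPh : is_partial_field Ph)
    (phi : Ph -> P) (hphi : pf_hom phi)
    (up : fund P -> Ph) (hup : lifting_function phi up)
    (h1 : (1 : P) + (1 : P) = Some (0 : P) -> (1 : Ph) + (1 : Ph) = Some (0 : Ph))
    (h2 : (exists2 t : P, (1 : P) + (1 : P) = Some t & t <> 0) ->
          exists2 t : Ph, (1 : Ph) + (1 : Ph) = Some t & t <> 0)
    (h3 : forall p q r : fund P,
        val p * val q * val r = 1 -> up p * up q * up r = 1) :
  exists psi : pf_lift P -> Ph, pf_hom psi /\ ~ pf_trivial psi.
Proof.
(* The choice is harmless: values are unique, which also yields both homomorphism laws. *)
have [psi psiP] := choice (pf_lift_upval hP hPh hup h3).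
have uniq := has_upval_uniq hP (hPh := hPh) hphi hup h1 h3.
exists psi; split; first split=> [p q|p q r /pf_of_ring_addE pq].
- apply: (uniq _ _ _ (psiP (p * q))); exact: has_upvalM.
- apply: (has_upvalD hP hphi hup h1 h3 (psiP p) (psiP q)).
  by rewrite pq; apply: psiP.
- have -> : pf_trivial psi = (psi 1 = 0) by [].
  rewrite (uniq _ _ _ (psiP 1) (has_upval1 hPh up)); exact: pf_one_neq0.
Qed.
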